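(* Let $\mathbb{F}$ be any field, $G$ any finite group, $X$ any (finite, nonempty) transitive $G$-set, and $0\neq f\in\mathbb{F}^X$. Let $S=\mathrm{supp}(f)$ and $S'=X-S$, fix $x_0\in S$, and let $\mathscr{S}=\zeta_{x_0}^{-1}(S)$, $\mathscr{S}'=\zeta_{x_0}^{-1}(S')$ and $X_{\mathrm{supp}(f)}=G_{\mathscr{S}}x_0$. Then $$|\mathrm{supp}(f)|\cdot\dim\mathbb{F}Gf\;\ge\;|X|+|\mathrm{supp}(f)|-|X_{\mathrm{supp}(f)}|.$$ The inequality is an equality if and only if $f$ is an $\mathscr{S}'^{-1}$-linear function and $\mathbb{F}f+\mathbb{F}\mathscr{S}'^{-1}f=\mathbb{F}Gf$.
   Context: $\mathbb{F}^X$ is the $\mathbb{F}$-vector space of all functions $X\to\mathbb{F}$. The group $G$ acts linearly on it by $(\alpha f)(x)=f(\alpha^{-1}x)$ for $\alpha\in G$, $x\in X$; it is identified as an $\mathbb{F}G$-module with the permutation module $\mathbb{F}X$ via $f\mapsto\sum_{x\in X}f(x)x$. The support is $\mathrm{supp}(f)=\{x\in X: f(x)\neq0\}$. For $x_0\in X$, the map $\zeta_{x_0}:G\to X$ is $\zeta_{x_0}(\alpha)=\alpha x_0$, and $\zeta_{x_0}^{-1}(Y)=\{\alpha\in G:\alpha x_0\in Y\}$ for $Y\subseteq X$. For a subset $\mathscr{S}\subseteq G$, its right stabilizer is the subgroup $G_{\mathscr{S}}=\{\alpha\in G:\mathscr{S}\alpha=\mathscr{S}\}$, and $G_{\mathscr{S}}x_0=\{\alpha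 x_0:\alpha\in G_{\mathscr{S}}\}$. For $\mathscr{A}\subseteq G$, $\mathscr{A}^{-1}=\{\alpha^{-1}:\alpha\in\mathscr{A}\}$. For $\mathscr{A}\subseteq G$, $\mathscr{A}f=\{\alpha f:\alpha\in\mathscr{A}\}$ and $\mathbb{F}\mathscr{A}f$ is the $\mathbb{F}$-linear span of $\mathscr{A}f$ (equal to $0$ if $\mathscr{A}=\emptyset$); $\mathbb{F}f$ is the span of $f$; $\mathbb{F}Gf$ is the $\mathbb{F}G$-submodule generated by $f$. All dimensions are over $\mathbb{F}$. For $\mathscr{A}\subseteq G$ and $0\neq f\in\mathbb{F}^X$ with $S=\mathrm{supp}(f)$, $f$ is called an $\mathscr{A}$-linear function if for all $\alpha,\beta\in\mathscr{A}$: (i) either $\alpha S=\beta S$ or $\alpha S\cap\beta S=\emptyset$; and (ii) if $\alpha S=\beta S$, then $\alpha f$ and $\beta f$ are linearly dependent over $\mathbb{F}$, i.e. one is a nonzero scalar multiple of the other. (For $\mathscr{A}=\emptyset$ the condition is vacuous.) *)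

(* Defs.v *)
From HB Require Import structures.
From mathcomp Require Import all_boot all_order all_algebra all_fingroup.

Set Implicit Arguments.
Unset Strict Implicit.
Unset Printing Implicit Defensive.

Import GRing.Theory GroupScope.
Local Open Scope ring_scope.

Section LeftAction.

Variables (gT : finGroupType) (X : finType) (to : {action gT &-> X}).

(* MathComp actions are right actions: to x (a * b) = to (to x a) b. Inverting *)
(* the group element is a bijection from right to left actions on X, and it    *)
(* preserves orbits (hence transitivity), so "to" ranges over all left G-sets. *)
Definition lact (a : gT) (x : X) : X := to x a^-1%g.

Lemma lact1 x : lact 1%g x = x.
Proof. by rewrite /lact invg1 act1. Qed.

Lemma lactM a b x : lact (a * b)%g x = lact a (lact b x).
Proof. by rewrite /lact invMg actM. Qed.

Definition zeta (x0 : X) (a : gT) : X := lact a x0.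

Definition rstab (A : {set gT}) : {set gT} := [set a | A :* a == A].

End LeftAction.

Section FunctionModule.

Variables (F : fieldType) (gT : finGroupType) (X : finType).
Variable to : {action gT &-> X}.

(* F^o is F regarded as a vector space over itself, which makes               *)
(* {ffun X -> F^o} the F-vector space of all functions X -> F.                 *)
Implicit Type f : {ffun X -> F^o}.

Definition supp f : {set X} := [set x | f x != 0].

Definition fact (a : gT) f : {ffun X -> F^o} := [ffun x => f (lact to a^-1%g x)].

Definition fspan (A : {set gT}) f : {vspace {ffun X -> F^o}} :=
  <<[seq fact a f | a in A]>>%VS.

Definition linear_function (A : {set gT}) f : Prop :=
  f != 0 /\
  forall a b : gT, a \in A -> b \in A ->
    (lact to a @: supp f = lact to b @: supp f \/
     [disjoint lact to a @: supp f & lact to b @: supp f]) /\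
    (lact to a @: supp f = lact to b @: supp f ->
     exists2 c : F, c != 0 & fact a f = c *: fact b f).

Definition Xsupp (x0 : X) f : {set X} :=
  [set lact to a x0 | a in rstab (zeta to x0 @^-1: supp f)].

Lemma fact1 f : fact 1%g f = f.
Proof. by apply/ffunP => x; rewrite ffunE invg1 lact1. Qed.

Lemma factM a b f : fact (a * b)%g f = fact a (fact b f).
Proof. by apply/ffunP => x; rewrite !ffunE invMg lactM. Qed.

Lemma fact_linear a : linear (fact a).
Proof. by move=> c f g; apply/ffunP => x; rewrite !ffunE. Qed.

HB.instance Definition _ a :=
  GRing.isLinear.Build F {ffun X -> F^o} {ffun X -> F^o} *:%R (fact a)
    (fact_linear a).

(* fspan [set: gT] f is the FG-submodule generated by f: the least G-stable    *)
(* subspace containing f.                                                      *)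
Lemma mem_fspanT f : f \in fspan [set: gT] f.
Proof.
rewrite memv_span //; apply/imageP; exists 1%g; first by rewrite inE.
by rewrite fact1.
Qed.

Lemma fspanT_stable f a g :
  g \in fspan [set: gT] f -> fact a g \in fspan [set: gT] f.
Proof.
move/coord_span => ->; rewrite linear_sum memv_suml // => i _.
rewrite linearZ memvZ //= memv_span //.
have /imageP[b _ ->] :
    [seq fact c f | c in [set: gT]]`_i \in [seq fact c f | c in [set: gT]].
  by rewrite mem_nth // size_tuple.
by apply/imageP; exists (a * b)%g; rewrite ?inE ?factM.
Qed.

Lemma fspanT_min f (U : {vspace {ffun X -> F^o}}) :
    f \in U -> (forall a g, g \in U -> fact a g \in U) ->
  (fspan [set: gT] f <= U)%VS.
Proof.
by move=> fU stabU; apply/span_subvP => _ /imageP[a _ ->]; apply: stabU.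
Qed.

End FunctionModule.

(* Main.v *)
Require Import Defs.
From HB Require Import structures.
From mathcomp Require Import all_boot all_order all_algebra all_fingroup.
From mathcomp Require Import zify.

Set Implicit Arguments.
Unset Strict Implicit.
Unset Printing Implicit Defensive.

Import GRing.Theory GroupScope.
Local Open Scope ring_scope.

(** Let A = S'^-1, the set of a with x0 outside aS.  By transitivity every
    point lies in equally many translates aS, so a point x all of whose
    translates contain x0 lies in exactly the same translates as x0, i.e. in
    X_supp(f); hence the aS with a in A cover exactly X - X_supp(f).  The union
    of the supports of a family of functions with supports of size |S| has at
    most |S| d points, d the dimension of the span, with equality for the
    translates of f by A exactly when f is A-linear.  Finally f is not in the
    span of A f, whose elements vanish at x0, so dim FGf >= 1 + d. *)

Lemma dim_addv_line (K : fieldType) (vT : vectType K) (U : {vspace vT}) v :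
  v \notin U -> \dim (<[v]> + U) = (\dim U).+1.
Proof.
move=> vU; have v0 : v != 0 by apply: contraNneq vU => ->; rewrite mem0v.
rewrite dimv_disjoint_sum ?dim_vline ?v0 //.
apply/eqP; rewrite -subv0; apply/subvP => w; rewrite memv_cap memv0.
case/andP=> /vlineP[c ->]; have [->|c0] := eqVneq c 0; rewrite ?scale0r //.
by move=> /(memvZ c^-1); rewrite scalerK // (negPf vU).
Qed.

(** * Unions of supports against dimensions of spans *)

Section Supports.

Variables (F : fieldType) (X : finType).
Implicit Types (v w : {ffun X -> F^o}) (s t : seq {ffun X -> F^o}).

Definition supps s : {set X} := \bigcup_(v <- s) supp v.

Lemma suppsP s x : reflect (exists2 v, v \in s & v x != 0) (x \in supps s).
Proof.
have -> : (x \in supps s) = has (fun v => v x != 0) s.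
  by elim: s => [|v s IHs]; rewrite /supps ?big_nil ?big_cons !inE //= -IHs.
exact: hasP.
Qed.

(** Evaluation at x is linear and vanishes on every member of s. *)
Lemma span_supps_eq0 s v x : v \in <<s>>%VS -> x \notin supps s -> v x = 0.
Proof.
move=> /(coord_span (X := in_tuple s)) -> xs.
rewrite sum_ffunE big1 // => i _; rewrite ffunE.
have [->|nz] := eqVneq (s`_i x) 0; first by rewrite scaler0.
by case/suppsP: xs; exists s`_i => //; rewrite mem_nth.
Qed.

Lemma supp_sub_supps s v : v \in <<s>>%VS -> supp v \subset supps s.
Proof.
move=> vs; apply/subsetP => x; rewrite inE; apply: contraR.
by move=> /(span_supps_eq0 vs) ->.
Qed.

(* Each new vector either lies in the span, adding no point, or raises the
   dimension by one and adds at most k points. *)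
Lemma card_supps_cat k s t : {in s, forall v, #|supp v| <= k}%N ->
  (#|supps (s ++ t)| + k * \dim <<t>> <= k * \dim <<s ++ t>> + #|supps t|)%N.
Proof.
elim: s => [|v s IHs] sk; first by rewrite addnC.
have {IHs} IH : (#|supps (s ++ t)| + k * \dim <<t>> <=
                 k * \dim <<s ++ t>> + #|supps t|)%N.
  by apply: IHs => w ws; apply: sk; rewrite inE ws orbT.
have vk : (#|supp v| <= k)%N by apply: sk; rewrite mem_head.
rewrite cat_cons span_cons {1}/supps big_cons -/(supps _).
have [vst|vst] := boolP (v \in <<s ++ t>>%VS).
  by rewrite (setUidPr (supp_sub_supps vst)) (addv_idPr _) // -memvE.
have := leq_card_setU (supp v) (supps (s ++ t)).
rewrite dim_addv_line // mulnS; case=> + _; lia.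
Qed.

Lemma card_supps k s : {in s, forall v, #|supp v| <= k}%N ->
  (#|supps s| <= k * \dim <<s>>)%N.
Proof.
move=> /(card_supps_cat [::]); rewrite cats0 span_nil dimv0 muln0 addn0.
by rewrite /supps big_nil cards0 addn0.
Qed.

Lemma dim_span2 v w : v != 0 -> w \notin <[v]>%VS -> \dim <<[:: w; v]>> = 2.
Proof.
(* [free] is by definition the equality of dimension and length. *)
move=> v0 wv; apply/eqP; rewrite -[_ == _]/(free [:: w; v]).
by rewrite free_cons span_seq1 wv seq1_free.
Qed.

(* Counting from v, w onwards instead of from scratch, an overlap of their
   supports would be lost in the bound. *)
Lemma supps_eq_disjoint k s v w : {in s, forall u, #|supp u| <= k}%N ->
  #|supps s| = (k * \dim <<s>>)%N -> v \in s -> w \in s ->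
  v != 0 -> w \notin <[v]>%VS -> [disjoint supp v & supp w].
Proof.
move=> sk eqs vs ws v0 wv.
have := card_supps_cat [:: w; v] sk.
have eqm : s ++ [:: w; v] =i s.
  move=> u; rewrite mem_cat !inE; case: (u \in s) / boolP => //= us.
  by apply/negP => /orP[] /eqP uE; rewrite uE ?vs ?ws in us.
have -> : supps (s ++ [:: w; v]) = supps s.
  by apply/setP => x; apply/suppsP/suppsP => -[u us ux]; exists u;
    rewrite // ?eqm // -?eqm.
(* The bound now reads 2k <= |supp w ∪ supp v|, so two supports of at most k points each cannot
   overlap. *)
rewrite (eq_span eqm) eqs dim_span2 // /supps !big_cons big_nil setU0.
have := sk _ vs; have := sk _ ws; rewrite -setI_eq0 -cards_eq0 setIC.
have := cardsUI (supp w) (supp v); lia.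
Qed.

Lemma supp_neq0 v : v != 0 -> (0 < #|supp v|)%N.
Proof.
move=> v0; rewrite card_gt0; apply: contraNneq v0 => sv; apply/eqP/ffunP => x.
by have := in_set0 x; rewrite -sv inE ffunE => /negbFE/eqP.
Qed.

Lemma suppZ c v : c != 0 -> supp (c *: v) = supp v.
Proof.
by move=> c0; apply/setP => x; rewrite !inE ffunE scaler_eq0 (negPf c0).
Qed.

End Supports.

(** * Translates of f by a subset of G *)

Section Translates.

Variables (F : fieldType) (gT : finGroupType) (X : finType).
Variable to : {action gT &-> X}.
Implicit Types (f : {ffun X -> F^o}) (A : {set gT}) (a b : gT) (x : X).

Lemma lactK a : cancel (lact to a) (lact to a^-1).
Proof. by move=> x; rewrite -lactM mulVg lact1. Qed.

Lemma lactKV a : cancel (lact to a^-1) (lact to a).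
Proof. by move=> x; rewrite -lactM mulgV lact1. Qed.

Lemma mem_lact_imset a (S : {set X}) x :
  (x \in lact to a @: S) = (lact to a^-1 x \in S).
Proof.
by rewrite -{1}[x](lactKV a) mem_imset //; apply: can_inj (lactK a).
Qed.

Lemma supp_fact a f : supp (fact to a f) = lact to a @: supp f.
Proof. by apply/setP => x; rewrite mem_lact_imset !inE ffunE. Qed.

Lemma card_supp_fact a f : #|supp (fact to a f)| = #|supp f|.
Proof. by rewrite supp_fact card_imset //; apply: can_inj (lactK a). Qed.

Lemma fact_eq0 a f : (fact to a f == 0) = (f == 0).
Proof.
apply/eqP/eqP => [f0|->]; last by rewrite linear0.
by rewrite -(fact1 to f) -(mulVg a) factM f0 linear0.
Qed.

Definition translates A f : seq {ffun X -> F^o} := [seq fact to a f | a in A].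

Lemma card_supp_translates A f :
  {in translates A f, forall v, #|supp v| <= #|supp f|}%N.
Proof. by move=> _ /imageP[a _ ->]; rewrite card_supp_fact. Qed.

Lemma mem_supps_translates A f x :
  reflect (exists2 a, a \in A & lact to a^-1 x \in supp f)
          (x \in supps (translates A f)).
Proof.
apply: (iffP (suppsP _ _)) => [[_ /imageP[a aA ->]]|[a aA]].
  by rewrite ffunE => ax; exists a; rewrite // inE.
rewrite inE => ax; exists (fact to a f); last by rewrite ffunE.
by apply/imageP; exists a.
Qed.

(** Passing to a set of sets merges equal translates of the support, so that [trivIset] can count
    their union. *)
Lemma supps_translates_cover A f :
  supps (translates A f) = cover [set lact to a @: supp f | a in A].
Proof.
apply/setP => x; apply/mem_supps_translates/bigcupP => [[a aA ax]|].
  by exists (lact to a @: supp f); rewrite ?imset_f ?mem_lact_imset.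
by case=> _ /imsetP[a aA ->]; rewrite mem_lact_imset; exists a.
Qed.

Lemma fact_in_fspan A f a : a \in A -> fact to a f \in fspan to A f.
Proof. by move=> aA; rewrite memv_span //; apply/imageP; exists a. Qed.

(** Translates with equal supports are proportional, so one translate per distinct support already
    spans. *)
Lemma linear_function_dim_le A f : linear_function to A f ->
  (\dim (fspan to A f) <= #|[set lact to a @: supp f | a in A]|)%N.
Proof.
case=> _ linA; set P := [set _ | a in A].
(* The default 1 is never reached on [P], whose members all come from some a in A. *)
pose rep B := odflt 1%g [pick a in A | lact to a @: supp f == B].
pose s := [seq fact to (rep B) f | B in P].
have sub : (fspan to A f <= <<s>>)%VS.
  apply/span_subvP => _ /imageP[a aA ->].
  have aP : lact to a @: supp f \in P by apply: imset_f.
  have : fact to (rep (lact to a @: supp f)) f \in <<s>>%VS.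
    by rewrite memv_span //; apply/imageP; exists (lact to a @: supp f).
  rewrite /rep; case: pickP => [b /andP[bA /eqP bE] /= bs|/(_ a)].
    have [_ /(_ (esym bE))[c _ ->]] := linA _ _ aA bA.
    exact: memvZ.
  by rewrite aA eqxx.
apply: leq_trans (dimvS sub) _; apply: leq_trans (dim_span _) _.
by rewrite size_image.
Qed.

(** If f is A-linear, the distinct supports are disjoint blocks of size |supp f|, and there are at
    least as many as the dimension. Conversely, equality forces non-proportional translates to have
    disjoint supports. *)
Lemma linear_functionP A f : f != 0 ->
  linear_function to A f <->
  #|supps (translates A f)| = (#|supp f| * \dim (fspan to A f))%N.
Proof.
move=> f0; split=> [linf|eqd].
  apply/eqP; rewrite eqn_leq card_supps /=; last exact: card_supp_translates.
  rewrite supps_translates_cover.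
  have /eqP <- : trivIset [set lact to a @: supp f | a in A].
    apply/trivIsetP => _ _ /imsetP[a aA ->] /imsetP[b bA ->] neq.
    by case: (linf.2 a b aA bA) => -[/eqP|//]; rewrite (negPf neq).
  rewrite (eq_bigr (fun=> #|supp f|)); last first.
    by move=> _ /imsetP[a _ ->]; rewrite -supp_fact card_supp_fact.
  by rewrite sum_nat_const mulnC leq_mul2r linear_function_dim_le ?orbT.
split=> // a b aA bA; rewrite -!supp_fact.
have [ma mb] : fact to a f \in translates A f /\ fact to b f \in translates A f.
  by split; apply/imageP; [exists a | exists b].
have [/vlineP[c ac]|nab] := boolP (fact to a f \in <[fact to b f]>%VS).
  have c0 : c != 0.
    by apply: contraNneq f0 => c0; rewrite -(fact_eq0 a) ac c0 scale0r.
  by split=> [|_]; [left; rewrite ac suppZ | exists c].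
have dis : [disjoint supp (fact to a f) & supp (fact to b f)].
  rewrite disjoint_sym.
  by apply: supps_eq_disjoint eqd mb ma _ nab; rewrite ?fact_eq0 //;
    apply: card_supp_translates.
(* Disjoint translates of a nonempty support cannot coincide, so the second clause is vacuous
   here. *)
split=> [|eqab]; first by right.
move: dis; rewrite eqab -setI_eq0 setIid -cards_eq0 card_supp_fact.
by have := supp_neq0 f0; case: #|supp f|.
Qed.

(** If g carries x to y under [lact], left multiplication by g maps the a with x in aS onto those
    with y in aS. *)
Lemma card_translates_at (S : {set X}) x y :
  [transitive [set: gT], on [set: X] | to] ->
  #|[set a | lact to a^-1 x \in S]| = #|[set a | lact to a^-1 y \in S]|.
Proof.
move=> trX; have /imsetP[g _ xg] : x \in orbit to [set: gT] y.
  by rewrite (atransP trX) ?inE.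
rewrite -(card_imset _ (mulgI g)); apply: eq_card => a; rewrite inE.
apply/imsetP/idP => [[b + ->]|ay].
  by rewrite inE xg /lact !invgK actM.
exists (g^-1 * a)%g; rewrite ?mulKVg // inE xg /lact invgK -actM mulKVg.
by move: ay; rewrite /lact invgK.
Qed.

Lemma Xsupp_supps_translates f x0 :
  [transitive [set: gT], on [set: X] | to] ->
  ~: Xsupp to x0 f =
    supps (translates ((zeta to x0 @^-1: ~: supp f)^-1)%g f).
Proof.
move=> trX; apply/setP => x; rewrite -[RHS]negbK in_setC; congr (~~ _).
pose E y := [set a | lact to a^-1 y \in supp f].
apply/imsetP/idP => [[g + ->]|xout].
  rewrite inE => /eqP gS; apply/mem_supps_translates => -[a].
  rewrite !inE /zeta negbK => /eqP ax0.
  rewrite -lactM => /negP; apply.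
  (* For T the preimage of supp f under [zeta], a^-1 lies outside T, so a^-1 g lies outside Tg =
     T. *)
  have : (a^-1 * g)%g \notin (zeta to x0 @^-1: supp f) :* g.
    by rewrite mem_rcoset mulgK !inE negbK /zeta ax0.
  by rewrite gS !inE negbK.
have subE : E x \subset E x0.
  apply/subsetP => a; rewrite !inE => ax; apply: contraNT xout => ax0.
  by apply/mem_supps_translates; exists a; rewrite !inE.
have /setP eqE : E x = E x0.
  by apply/eqP; rewrite eqEcard subE (card_translates_at _ x0 x trX) leqnn.
have /imsetP[h _ xh] : x \in orbit to [set: gT] x0.
  by rewrite (atransP trX) ?inE.
have xg : x = lact to h^-1 x0 by rewrite /lact invgK.
exists h^-1%g => //; rewrite inE; apply/eqP/setP => a.
rewrite mem_rcoset invgK !inE /zeta.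
(* At this element, [eqE] says that a x0 and ah x0 are both in supp f or both outside. *)
have := eqE (a * h)^-1%g; rewrite !inE invgK => <-.
by rewrite xg -lactM mulgK.
Qed.

End Translates.

Theorem corollary3p13 (F : fieldType) (gT : finGroupType) (X : finType)
    (to : {action gT &-> X})
    (trX : [transitive [set: gT], on [set: X] | to])
    (f : {ffun X -> F^o}) (f_neq0 : f != 0)
    (x0 : X) (x0S : x0 \in supp f) :
  let S := supp f in
  let S' := ~: S in
  let A' := zeta to x0 @^-1: S' in
  (#|S| * \dim (fspan to [set: gT] f) >= #|X| + #|S| - #|Xsupp to x0 f|)%N /\
  ((#|S| * \dim (fspan to [set: gT] f) = #|X| + #|S| - #|Xsupp to x0 f|)%N <->
   linear_function to (A'^-1)%g f /\
   (<[f]> + fspan to (A'^-1)%g f)%VS = fspan to [set: gT] f).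
Proof.
move=> S S' A'; set A := (A'^-1)%g.
have S_gt0 : (0 < #|S|)%N by apply: supp_neq0.
have cardA : #|supps (translates to A f)| = (#|X| - #|Xsupp to x0 f|)%N.
  by rewrite -Xsupp_supps_translates // cardsCs setCK.
have leA : (#|supps (translates to A f)| <= #|S| * \dim (fspan to A f))%N.
  by apply: card_supps; apply: card_supp_translates.
have fA : f \notin fspan to A f.
  apply: contraL x0S => fA; rewrite inE (span_supps_eq0 fA) ?eqxx //.
  by apply/mem_supps_translates => -[a]; rewrite !inE /zeta => /negP.
have dimD : \dim (<[f]> + fspan to A f) = (\dim (fspan to A f)).+1.
  exact: dim_addv_line.
have sub : (<[f]> + fspan to A f <= fspan to [set: gT] f)%VS.
  rewrite subv_add -memvE mem_fspanT; apply/span_subvP => _ /imageP[a _ ->].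
  by apply: fact_in_fspan; rewrite inE.
have leT := dimvS sub; rewrite dimD in leT.
(* Needed to regroup the truncated subtraction. *)
have leX : (#|Xsupp to x0 f| <= #|X|)%N by apply: max_card.
rewrite linear_functionP // -/S cardA.
have -> : (#|X| + #|S| - #|Xsupp to x0 f| = #|S| + (#|X| - #|Xsupp to x0 f|))%N.
  by rewrite addnC addnBA.
rewrite -cardA.
(* With [leA] this gives a chain of two inequalities from the lower bound to |S| dim FGf. Equality
   of its ends forces both: [leA] encodes linearity, [leM] the equality of spans, as |S| > 0. *)
have leM : (#|S| + #|S| * \dim (fspan to A f) <=
            #|S| * \dim (fspan to [set: gT] f))%N.
  by rewrite -mulnS leq_mul2l leT orbT.
split; first lia.
split=> [eqT|[-> <-]]; last by rewrite dimD mulnS.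
split; first by lia.
by apply/eqP; rewrite eqEdim sub dimD -(leq_pmul2l S_gt0) mulnS eqT leq_add2l.
Qed.
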